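(* Let $\rho>0$ and let $K\ge1$ be an integer. Let $\xi_\pm=1+\rho\pm\sqrt{1+\rho^2}$ and $$g(i)=-\frac{\xi_+^i-\xi_-^i}{\xi_+-\xi_-}\qquad(i\in\mathbb N).$$ The invariant distribution $\pi_K$ of the symmetric join-the-shortest-queue process with capacity $K$ satisfies the following. (i) For $0\le j<k\le K$, $$\pi_K(j,k)=\sum_{l=k}^K\pi_K(0,l)\Big(g^{\ast(l-k+1)}(j)-g^{\ast(l-k+1)}(j+1)\Big),$$ and for $0\le k<K$, $$\pi_K(k,k)=-\frac1\rho\sum_{l=k+1}^K\pi_K(0,l)\,g^{\ast(l-k)}(k+1).$$ (ii) Given $\pi_K(K,K)$, the stationary probabilities $\pi_K(0,l)$, $l=0,\dots,K$, are characterized by (i.e. are the unique solution of) the following relations: $$\pi_K(0,K)=\frac{\pi_K(K,K)}{2\rho\,\big(g(K-1)-g(K)\big)}$$ and, for $k=0,\dots,K-1$, $$\sum_{l=k}^K\pi_K(0,l)\Big(g^{\ast(l-k+1)}(k+2)-(2+\rho)\,g^{\ast(l-k+1)}(k+1)\Big)=0.$$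
   Context: $\mathbb N=\{0,1,2,\dots\}$. For $\varphi,\psi:\mathbb N\to\mathbb C$, $(\varphi\ast\psi)(n)=\sum_{m=0}^n\varphi(m)\psi(n-m)$, and for $k\ge1$, $\varphi^{\ast k}$ is the $k$-fold convolution of $\varphi$ with itself ($\varphi^{\ast1}=\varphi$). Symmetric finite-capacity JSQ model: two one-server queues, each of capacity $K$; service times are exponential with parameter $1$ at both queues; customers arrive according to a Poisson process with parameter $2\rho$ and join the shortest queue, or either queue with probability $1/2$ if both lengths are equal; when both queues have length $K$ arriving customers are lost. The queue-length process $(L_1(t),L_2(t))_{t\ge0}$ is the continuous-time Markov chain on $\{0,\dots,K\}^2$ with the following transition rates ($e_1,e_2$ the unit vectors). From $(k,k)$: to $(k,k)+e_1$ and to $(k,k)+e_2$ at rate $\rho$ each if $k<K$; to $(k,k)-e_1$ and to $(k,k)-e_2$ at rate $1$ each if $k>0$. From $(j,k)$ with $j<k$: to $(j+1,k)$ at rate $2\rho$, to $(j-1,k)$ at rate $1$ if $j>0$, to $(j,k-1)$ at rate $1$. From $(k,j)$ with $j<k$: to $(k,j+1)$ at rate $2\rho$, to $(k,j-1)$ at rate $1$ if $j>0$, to $(k-1,j)$ at rate $1$. The chain is irreducible, and $\pi_K$ denotes its unique invariant probability distribution; by symmetry $\pi_K(j,k)=\pi_K(k,j)$. *)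

(* Defs.v *)
From mathcomp Require Import all_boot all_order all_algebra.
From mathcomp Require Import reals.

Set Implicit Arguments.
Unset Strict Implicit.
Unset Printing Implicit Defensive.

Import Order.TTheory GRing.Theory Num.Theory.
Local Open Scope ring_scope.

Definition convolution (A : nzRingType) (phi psi : nat -> A) : nat -> A :=
  fun n => \sum_(m < n.+1) phi m * psi (n - m)%N.

(* [convolution_power phi 1] is convertible to [phi]; the junk-free value at
   exponent 0 is the unit of the convolution. *)
Definition convolution_power (A : nzRingType) (phi : nat -> A) (k : nat) :
    nat -> A :=
  iterop k (@convolution A) phi (fun n => (n == 0%N)%:R).

Definition generator (R : realType) (S : finType) (q : S -> S -> R)
    (s t : S) : R :=
  if s == t then - \sum_(u | u != s) q s u else q s t.

(* Invariant probability distribution of the continuous-time Markov chain with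
   transition rates [q s t], [s != t], on a finite state space: [pi Q = 0]. *)
Definition invariant_distribution (R : realType) (S : finType)
    (q : S -> S -> R) (pi : S -> R) : Prop :=
  [/\ forall s, 0 <= pi s,
      \sum_s pi s = 1
    & forall t, \sum_s pi s * generator q s t = 0].

(* Transition rate from [s] to [t]. Departures are common to all cases: each
   nonempty queue loses a customer at rate 1. Off the diagonal the shorter
   queue is below capacity, so an arrival is never lost there. *)
Definition jsq_rate (R : realType) (rho : R) (K : nat) (s t : nat * nat) : R :=
  let: (a, b) := s in
  (if a == b then
     rho *+ ((a < K)%N && (t == (a.+1, b)))
     + rho *+ ((a < K)%N && (t == (a, b.+1)))
   else if (a < b)%N then (2 * rho) *+ (t == (a.+1, b))
   else (2 * rho) *+ (t == (a, b.+1)))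
  + ((0 < a)%N && (t == (a.-1, b)))%:R
  + ((0 < b)%N && (t == (a, b.-1)))%:R.

Definition jsq_state (K : nat) : finType := ('I_K.+1 * 'I_K.+1)%type.

Definition jsq_invariant (R : realType) (rho : R) (K : nat)
    (pi : jsq_state K -> R) : Prop :=
  invariant_distribution
    (fun s t : jsq_state K =>
       jsq_rate rho K (val s.1, val s.2) (val t.1, val t.2)) pi.

Definition xi_plus (R : realType) (rho : R) : R :=
  1 + rho + Num.sqrt (1 + rho ^+ 2).

Definition xi_minus (R : realType) (rho : R) : R :=
  1 + rho - Num.sqrt (1 + rho ^+ 2).

Definition jsq_g (R : realType) (rho : R) (i : nat) : R :=
  - ((xi_plus rho ^+ i - xi_minus rho ^+ i) / (xi_plus rho - xi_minus rho)).

(* Main.v *)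
(* Extend [pi] by zero outside the state space. The sum of
   [`|pi (a, b) - pi (b, a)|] over row [b] of the triangle [a < b] is
   nondecreasing in [b] and vanishes beyond [K], so [pi] is symmetric. Above the
   diagonal the balance equation at [(j, k)] expresses [pi (j + 1, k)] through
   [pi (j, k)], [pi (j - 1, k)] and [pi (j, k + 1)]; convolving with [g] obeys
   the same recurrence, because [g] has generating function
   [- z / (1 - 2 (1 + rho) z + 2 rho z ^ 2)], whence the first formula by
   descending induction on [k]. Rows then telescope, and the flux through the
   cut [max <= k] yields the diagonal. The relations of (ii) are the balance
   equations next to the diagonal; they form a triangular linear system in
   [pi (0, l)] with nonzero diagonal coefficients. *)
Require Import Defs.
From mathcomp Require Import all_boot all_order all_algebra.
From mathcomp Require Import reals.
From mathcomp Require Import ring lra zify.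

Set Implicit Arguments.
Unset Strict Implicit.

Import Order.TTheory GRing.Theory Num.Theory.
Local Open Scope ring_scope.

(** * Values, recurrence and monotonicity of [g] *)

Lemma jsq_g0 (R : realType) (rho : R) : jsq_g rho 0 = 0.
Proof. by rewrite /jsq_g !expr0 subrr mul0r oppr0. Qed.

Lemma jsq_g1 (R : realType) (rho : R) : jsq_g rho 1 = -1.
Proof.
rewrite /jsq_g !expr1 divff //.
have : 0 < Num.sqrt (1 + rho ^+ 2).
  by rewrite sqrtr_gt0 ltr_pwDl ?ltr01 ?sqr_ge0.
rewrite /xi_plus /xi_minus => s_gt0; lra.
Qed.

(** [xi_plus] and [xi_minus] are the roots of [z ^ 2 = 2 (1 + rho) z - 2 rho]. *)
Lemma jsq_g_rec (R : realType) (rho : R) i :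
  jsq_g rho i.+2 = 2 * (1 + rho) * jsq_g rho i.+1 - 2 * rho * jsq_g rho i.
Proof.
have s2 : Num.sqrt (1 + rho ^+ 2) ^+ 2 = 1 + rho ^+ 2.
  by rewrite sqr_sqrtr // addr_ge0 ?ler01 ?sqr_ge0.
have plusE : xi_plus rho ^+ 2 = 2 * (1 + rho) * xi_plus rho - 2 * rho.
  by rewrite /xi_plus; ring: s2.
have minusE : xi_minus rho ^+ 2 = 2 * (1 + rho) * xi_minus rho - 2 * rho.
  by rewrite /xi_minus; ring: s2.
rewrite /jsq_g -!(addn2 i) !exprD plusE minusE !exprS; ring.
Qed.

Lemma jsq_g_decr (R : realType) (rho : R) (rho_gt0 : 0 < rho) i :
  jsq_g rho i.+1 < jsq_g rho i.
Proof.
(* The induction also carries that the decrements [d_i] grow: [d_(i+2) - d_(i+1) = 2 rho (d_(i+1) -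
   d_i) + d_(i+1)]. *)
suff : 0 < jsq_g rho i - jsq_g rho i.+1
       <= jsq_g rho i.+1 - jsq_g rho i.+2 by case/andP=> *; lra.
elim: i => [|i].
  by rewrite jsq_g_rec jsq_g0 jsq_g1; apply/andP; split; lra.
move=> /andP[d_gt0 d_le]; rewrite (jsq_g_rec rho i.+1).
set d := jsq_g rho i.+1 - _ in d_le *.
have : 0 < rho * d by rewrite mulr_gt0 //; apply: lt_le_trans d_le.
have : rho * (jsq_g rho i - jsq_g rho i.+1) <= rho * d by rewrite ler_pM2l.
have := jsq_g_rec rho i; rewrite /d in d_le * => *; apply/andP; split; lra.
Qed.

(** * Convolution powers of [g] *)

Section JSQPower.
Context (R : realType) (rho : R).

Notation gpow := (convolution_power (jsq_g rho)).

Lemma convolution_jsq_g0 (phi : nat -> R) : convolution (jsq_g rho) phi 0 = 0.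
Proof. by rewrite /convolution big_ord1 jsq_g0 mul0r. Qed.

Lemma convolution_jsq_g1 (phi : nat -> R) :
  convolution (jsq_g rho) phi 1 = - phi 0.
Proof.
by rewrite /convolution big_ord_recl big_ord1 jsq_g0 jsq_g1 mul0r add0r mulN1r.
Qed.

(** In generating functions, [(1 - 2 (1 + rho) z + 2 rho z ^ 2) G(z) Phi(z) = - z Phi(z)]; the
    source term comes from [g 1 = -1]. *)
Lemma convolution_jsq_g_rec (phi : nat -> R) j :
  convolution (jsq_g rho) phi j.+2 =
    2 * (1 + rho) * convolution (jsq_g rho) phi j.+1
    - 2 * rho * convolution (jsq_g rho) phi j - phi j.+1.
Proof.
rewrite /convolution 2![in LHS]big_ord_recl [in X in _ * X - _]big_ord_recl.
rewrite /= jsq_g0 jsq_g1 !mul0r !add0r mulN1r subSS subn0 [RHS]addrC.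
congr (_ + _); rewrite !mulr_sumr -sumrB; apply: eq_bigr => m _.
rewrite /bump /= !add1n jsq_g_rec !subSS; ring.
Qed.

(** [iterop] starts from the sequence itself, so only [n = 0] involves the unit of the
    convolution. *)
Lemma convolution_powerS n j :
  gpow n.+1 j = convolution (jsq_g rho) (gpow n) j.
Proof.
case: n => [|n] //=; rewrite /convolution big_ord_recr /= subnn eqxx mulr1.
rewrite big1 ?add0r // => m _.
by rewrite subn_eq0 leqNgt ltn_ord mulr0.
Qed.

Lemma gpowS0 n : gpow n.+1 0 = 0.
Proof. by rewrite convolution_powerS convolution_jsq_g0. Qed.

Lemma gpowS1 n : gpow n.+1 1 = - (n == 0%N)%:R.
Proof.
rewrite convolution_powerS convolution_jsq_g1.
by case: n => [|n]; rewrite ?gpowS0.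
Qed.

Lemma gpowS_rec n j :
  gpow n.+1 j.+2 =
    2 * (1 + rho) * gpow n.+1 j.+1 - 2 * rho * gpow n.+1 j - gpow n j.+1.
Proof. by rewrite !convolution_powerS convolution_jsq_g_rec. Qed.

End JSQPower.

(** * Series in the boundary masses *)

Section BoundarySeries.
Context (R : realType) (rho : R) (K : nat) (x : 'I_K.+1 -> R).

Notation gpow := (convolution_power (jsq_g rho)).

(** For [x l = pi (0, l)], the first formula of (i) is [pi (j, k) = h k j - h k j.+1]; [x] is left
    general for the uniqueness in (ii). *)
Definition boundary_series (k j : nat) : R :=
  \sum_(l < K.+1 | (k <= l)%N) x l * gpow (l - k + 1)%N j.

Notation h := boundary_series.

Lemma boundary_series0 k : h k 0 = 0.
Proof. by rewrite /h big1 // => l _; rewrite addn1 gpowS0 mulr0. Qed.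

Lemma boundary_series1 (k : 'I_K.+1) : h k 1 = - x k.
Proof.
rewrite /h (bigD1 k) //= subnn gpowS1 mulrN1 big1 ?addr0 // => l /andP[kl nkl].
by rewrite addn1 gpowS1 subn_eq0 leqNgt ltn_neqAle eq_sym nkl kl oppr0 mulr0.
Qed.

Lemma boundary_series_out j : h K.+1 j = 0.
Proof.
by rewrite /h big_pred0 // => l; rewrite leqNgt ltn_ord.
Qed.

Lemma boundary_series_rec k j :
  h k j.+2 = 2 * (1 + rho) * h k j.+1 - 2 * rho * h k j - h k.+1 j.+1.
Proof.
(* The term [l = k] may be added: it carries the convolution unit at a positive index, which is
   0. *)
have -> : h k.+1 j.+1 = \sum_(l < K.+1 | (k <= l)%N) x l * gpow (l - k)%N j.+1.
  rewrite /h big_mkcond [RHS]big_mkcond; apply: eq_bigr => l _.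
  case: (ltngtP k l) => [kl|//|->]; last by rewrite subnn mulr0.
  by congr (_ * gpow _ _); lia.
rewrite /h !mulr_sumr -!sumrB; apply: eq_bigr => l _.
rewrite addn1 gpowS_rec; ring.
Qed.

End BoundarySeries.

(** * Balance equations of the chain *)

Lemma invariant_balance (R : realType) (S : finType) (q : S -> S -> R) pi :
  invariant_distribution q pi -> (forall s, q s s = 0) ->
  forall t, (\sum_u q t u) * pi t = \sum_s pi s * q s t.
Proof.
move=> [_ _ inv] q_diag t.
have := inv t; rewrite (bigD1 t) //= /generator eqxx.
under eq_bigr => s /negbTE-> do [].
move=> /eqP; rewrite mulrN addrC subr_eq0 => /eqP into.
rewrite (bigD1 t) //= [RHS](bigD1 t) //= q_diag mulr0 !add0r.
by rewrite mulrC -into.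
Qed.

Section Balance.
Context (R : realType) (rho : R) (K : nat).

(** Arrivals joining the queue of length [a] when the other has length [b]; exchanging the arguments
    gives the other queue. *)
Definition arrival_rate (a b : nat) : R :=
  if a == b then rho *+ (a < K)%N else if (a < b)%N then 2 * rho else 0.

Lemma arrival_rate_full a b : (K <= a)%N -> (b <= K)%N -> arrival_rate a b = 0.
Proof.
move=> Ka bK; rewrite /arrival_rate ltnNge Ka mulr0n.
by rewrite ltnNge (leq_trans bK Ka) if_same.
Qed.

Lemma jsq_rateE (a b : nat) (t : nat * nat) :
  jsq_rate rho K (a, b) t =
    arrival_rate a b *+ (t == (a.+1, b)) + arrival_rate b a *+ (t == (a, b.+1))
    + ((0 < a)%N && (t == (a.-1, b)))%:R
    + ((0 < b)%N && (t == (a, b.-1)))%:R.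
Proof.
rewrite /jsq_rate /arrival_rate.
case: (ltngtP a b) => [_|_|->]; rewrite ?mul0rn ?addr0 ?add0r //.
by rewrite -!mulrnA !mulnb.
Qed.

Definition nat_pair (s : jsq_state K) : nat * nat := (val s.1, val s.2).

(* At most one term, and 0 outside the state space. *)
Definition extended_mass (pi : jsq_state K -> R) (a b : nat) : R :=
  \sum_(s | nat_pair s == (a, b)) pi s.

Lemma extended_massE pi (j k : 'I_K.+1) : extended_mass pi j k = pi (j, k).
Proof. by rewrite /extended_mass (big_pred1 (j, k)). Qed.

Lemma extended_mass_out pi a b : ~~ ((a <= K) && (b <= K))%N ->
  extended_mass pi a b = 0.
Proof.
move=> out; rewrite /extended_mass big_pred0 // => -[i j].
apply/negbTE; apply: contra out => /eqP[<- <-].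
by rewrite !leq_ord.
Qed.

Lemma sum_rate_into (pi : jsq_state K -> R) (c : nat -> nat -> R) a b :
  \sum_s pi s * (c (val s.1) (val s.2) *+ (nat_pair s == (a, b))) =
    c a b * extended_mass pi a b.
Proof.
rewrite /extended_mass mulr_sumr [RHS]big_mkcond; apply: eq_bigr => s _.
by case: eqP => [[<- <-]|_]; rewrite ?mulr0 // mulrC.
Qed.

Lemma sum_rate_from (c : R) a b : (a <= K)%N -> (b <= K)%N ->
  \sum_(s : jsq_state K) c *+ (nat_pair s == (a, b)) = c.
Proof.
rewrite -ltnS => aK; rewrite -ltnS => bK.
rewrite (bigD1 (Ordinal aK, Ordinal bK)) //= eqxx big1 ?addr0 // => -[i j].
move=> /eqP nij; case: eqP => // -[ia jb].
by case: nij; congr (_, _); apply: val_inj.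
Qed.

(** Outflow against inflow. The guards cancel the terms in [a.-1] and [b.-1] at 0; the departure
    terms may reach beyond [K], where the extended mass is 0. *)
Definition balanced (p : nat -> nat -> R) : Prop :=
  forall a b, (a <= K)%N -> (b <= K)%N ->
  (arrival_rate a b + arrival_rate b a + (0 < a)%:R + (0 < b)%:R) * p a b =
    arrival_rate a.-1 b * p a.-1 b *+ (0 < a)
    + arrival_rate b.-1 a * p a b.-1 *+ (0 < b) + p a.+1 b + p a b.+1.

Lemma extended_mass_balanced pi :
  jsq_invariant rho pi -> balanced (extended_mass pi).
Proof.
move=> /invariant_balance inv a b aK bK; set p := extended_mass pi.
have aS : (a < K.+1)%N by []; have bS : (b < K.+1)%N by [].
pose t : jsq_state K := (Ordinal aS, Ordinal bS).
have -> : p a b = pi t.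
  by exact: (extended_massE pi (Ordinal aS) (Ordinal bS)).
have out : \sum_u jsq_rate rho K (nat_pair t) (nat_pair u) =
    arrival_rate a b + arrival_rate b a + (0 < a)%:R + (0 < b)%:R.
  under eq_bigr => u _ do rewrite jsq_rateE.
  rewrite !big_split /=; congr (_ + _ + _ + _).
  (* An arrival at a full queue would leave the state space, but its rate is 0. *)
  - have [aK'|Ka] := ltnP a K; first exact: sum_rate_from.
    by rewrite (arrival_rate_full Ka bK) big1 // => u _; rewrite mul0rn.
  - have [bK'|Kb] := ltnP b K; first exact: sum_rate_from.
    by rewrite (arrival_rate_full Kb aK) big1 // => u _; rewrite mul0rn.
  - case: (posnP a) => [->|a_gt0]; first by rewrite big1.
    apply: (sum_rate_from 1) => //; lia.
  - case: (posnP b) => [->|b_gt0]; first by rewrite big1.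
    apply: (sum_rate_from 1) => //; lia.
have into : \sum_s pi s * jsq_rate rho K (nat_pair s) (nat_pair t) =
    arrival_rate a.-1 b * p a.-1 b *+ (0 < a)
    + arrival_rate b.-1 a * p a b.-1 *+ (0 < b) + p a.+1 b + p a b.+1.
  under eq_bigr => s _ do rewrite jsq_rateE !mulrDr.
  rewrite !big_split /= -!addrA; congr (_ + (_ + (_ + _))).
  - have [a0|a_gt0] := posnP a.
      by rewrite a0 big1 // => s _; rewrite xpair_eqE /= a0 mulr0.
    rewrite mulr1n -sum_rate_into; apply: eq_bigr => s _.
    by congr (_ * (_ *+ nat_of_bool _)); rewrite !xpair_eqE /=; lia.
  - have [b0|b_gt0] := posnP b.
      by rewrite b0 big1 // => s _; rewrite xpair_eqE /= b0 andbF mulr0.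
    rewrite mulr1n -(sum_rate_into pi (fun c d => arrival_rate d c)).
    apply: eq_bigr => s _.
    by congr (_ * (_ *+ nat_of_bool _)); rewrite !xpair_eqE /=; lia.
  - rewrite -[RHS]mul1r -(sum_rate_into pi (fun _ _ => 1)).
    apply: eq_bigr => s _.
    by congr (_ * (_ *+ nat_of_bool _)); rewrite !xpair_eqE /=; lia.
  - rewrite -[RHS]mul1r -(sum_rate_into pi (fun _ _ => 1)).
    apply: eq_bigr => s _.
    by congr (_ * (_ *+ nat_of_bool _)); rewrite !xpair_eqE /=; lia.
rewrite -out -into; apply: (inv _ t) => s.
(* Rates from a state to itself vanish: each jump changes a length, and the guard [0 < a] excludes
   [a.-1 = a]. *)
rewrite -[LHS]/(jsq_rate rho K (nat_pair s) (nat_pair s)) jsq_rateE.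
have off (e : bool) (c : R) : e = false -> c *+ e = 0 by move=> ->.
by rewrite !off ?addr0 //; rewrite !xpair_eqE; lia.
Qed.

End Balance.

(** * Balance equations above and on the diagonal *)

Section BalancedMass.
Context (R : realType) (rho : R) (K : nat) (p : nat -> nat -> R).
Hypothesis p_balanced : balanced rho K p.

(** Supplies the equations below the diagonal before symmetry is known. *)
Lemma balanced_swap : balanced rho K (fun a b => p b a).
Proof. by move=> a b aK bK; have := p_balanced bK aK; lra. Qed.

Lemma balanced_above a b : (a < b <= K)%N ->
  (2 * rho + (0 < a)%:R + 1) * p a b =
    2 * rho * p a.-1 b *+ (0 < a) + rho * p a a *+ (a.+1 == b)
    + p a.+1 b + p a b.+1.
Proof.
move=> /andP[ab bK]; have := p_balanced (leq_trans (ltnW ab) bK) bK.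
have arrE c : (c < b)%N -> arrival_rate rho K c b = 2 * rho.
  by move=> cb; rewrite /arrival_rate cb ltn_eqF.
have arr0 : arrival_rate rho K b a = 0.
  by rewrite /arrival_rate gtn_eqF // ltnNge (ltnW ab).
(* From [(a, b.-1)] an arrival joins the second queue only on a tie, and then [a < K]. *)
have arrP : arrival_rate rho K b.-1 a = rho *+ (a.+1 == b).
  have [ab1|ab1] := eqVneq a.+1 b.
    by rewrite -ab1 /arrival_rate /= eqxx (leq_trans ab bK).
  have ab2 : (a < b.-1)%N by lia.
  by rewrite /arrival_rate gtn_eqF // ltnNge (ltnW ab2).
have b_gt0 : (0 < b)%N by exact: leq_trans ab.
have a1b : (a.-1 < b)%N by apply: leq_ltn_trans ab; exact: leq_pred.
rewrite arrE // arr0 arrE // arrP b_gt0 mulr1n addr0 => ->.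
by have [<-|_] := eqVneq a.+1 b; rewrite //= !mulr0n mul0r.
Qed.

(** Half of the balance equation at [(a, a)], whose flows pair up by symmetry. *)
Lemma balanced_diag a : (a <= K)%N -> (forall b c, p b c = p c b) ->
  (rho *+ (a < K) + (0 < a)%:R) * p a a =
    2 * rho * p a.-1 a *+ (0 < a) + p a a.+1.
Proof.
move=> aK p_sym; have := p_balanced aK aK.
have [->|a_gt0] := posnP a.
  by rewrite /arrival_rate eqxx (p_sym 1 0) /=; lra.
rewrite (p_sym a a.-1) (p_sym a.+1 a) /arrival_rate eqxx ltn_eqF ?prednK //=.
by rewrite leqnn !mulr1n; lra.
Qed.

End BalancedMass.

(** Transitions of the shorter queue telescope along a row; departures from the longer queue leave
    the row total. *)
Lemma row_sum (R : comNzRingType) (c : R) (f : nat -> R) n :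
  \sum_(a < n.+1)
      ((c + (0 < a)%:R + 1) * f a - c * f a.-1 *+ (0 < a) - f a.+1) =
  c * f n + \sum_(a < n.+1) f a - f n.+1.
Proof.
elim: n => [|n IH]; first by rewrite !big_ord1 /=; ring.
by rewrite big_ord_recr IH [in RHS]big_ord_recr /=; ring.
Qed.

(** * Symmetry of balanced masses *)

Section Symmetry.
Context (R : realType) (rho : R) (K : nat) (p : nat -> nat -> R).
Hypotheses (rho_gt0 : 0 < rho) (p_balanced : balanced rho K p).
Hypothesis p_out : forall a b, ~~ ((a <= K) && (b <= K))%N -> p a b = 0.

Let gap a b : R := `|p a b - p b a|.
Let row_gap b : R := \sum_(a < b) gap a b.

Lemma row_gap_le n : (n.+1 <= K)%N -> row_gap n.+1 <= row_gap n.+2.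
Proof.
move=> nK.
(* The gaps satisfy the balance equation above the diagonal as an inequality:
   the diagonal source term, being symmetric, cancels. *)
have gap_le a : (a < n.+1)%N ->
    (2 * rho + (0 < a)%:R + 1) * gap a n.+1
    - 2 * rho * gap a.-1 n.+1 *+ (0 < a) - gap a.+1 n.+1 <= gap a n.+2.
  move=> an.
  have aK : (a < n.+1 <= K)%N by rewrite an nK.
  have up := balanced_above p_balanced aK.
  have lo := balanced_above (balanced_swap p_balanced) aK.
  have c_ge0 : 0 <= 2 * rho + (0 < a)%:R + 1.
    by rewrite !addr_ge0 ?mulr_ge0 ?ler0n // ltW.
  have a_ge0 : 0 <= 2 * rho by rewrite mulr_ge0 // ltW.
  rewrite !lerBlDr /gap -[X in X * _ <= _]ger0_norm // -normrM mulrBr up lo.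
  rewrite -[in leRHS](ger0_norm a_ge0) -normrM -normrMn mulrBr mulrnBl.
  rewrite [leRHS]addrC addrA; apply: le_trans (lerD (ler_normD _ _) (lexx _)).
  apply: le_trans (ler_normD _ _); rewrite le_eqVlt; apply/orP; left.
  by apply/eqP; congr `|_|; ring.
have rowE := row_sum (2 * rho) (gap^~ n.+1) n.
have : 2 * rho * gap n n.+1 + row_gap n.+1 - gap n.+1 n.+1
       <= \sum_(a < n.+1) gap a n.+2.
  by rewrite -rowE; apply: ler_sum => a _; apply: gap_le.
have -> : row_gap n.+2 = \sum_(a < n.+1) gap a n.+2 + gap n.+1 n.+2.
  by rewrite /row_gap big_ord_recr.
(* The negative boundary term of the row sum lies on the diagonal, where the gap is 0. *)
have -> : gap n.+1 n.+1 = 0 by rewrite /gap subrr normr0.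
have : 0 <= 2 * rho * gap n n.+1 by rewrite !mulr_ge0 ?normr_ge0 // ltW.
have : 0 <= gap n.+1 n.+2 by exact: normr_ge0.
by move=> *; lra.
Qed.

Lemma balanced_sym a b : p a b = p b a.
Proof.
(* Descends from the zero row [K.+1]; row 0 is an empty sum, treated apart. *)
have row0 m : row_gap (K.+1 - m) <= 0.
  elim: m => [|m IH].
    rewrite subn0 /row_gap big1 ?lexx // => c _.
    by rewrite /gap !p_out ?subrr ?normr0 // ltnn ?andbF.
  have [mK|Km] := ltnP m K; last first.
    have -> : (K.+1 - m.+1 = 0)%N by lia.
    by rewrite /row_gap big_ord0 lexx.
  apply: le_trans IH; have -> : (K.+1 - m = (K - m.+1).+2)%N by lia.
  by rewrite subSn //; apply: row_gap_le; lia.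
wlog ab : a b / (a < b)%N => [hwlog|].
  by have [/hwlog|/hwlog|->] := ltngtP a b.
have [bK|Kb] := leqP b K; last by rewrite !p_out //; lia.
have := row0 (K.+1 - b)%N; rewrite subKn; last by lia.
rewrite /row_gap (bigD1 (Ordinal ab)) //= => le0.
apply/eqP; rewrite -subr_eq0 -normr_le0; apply: le_trans le0.
by rewrite lerDl sumr_ge0 // => c _; exact: normr_ge0.
Qed.

End Symmetry.

(** * Stationary masses in terms of the boundary masses *)

Section BoundaryFormula.
Context (R : realType) (rho : R) (K : nat) (p : nat -> nat -> R).
Hypothesis p_balanced : balanced rho K p.
Hypothesis p_out : forall a b, ~~ ((a <= K) && (b <= K))%N -> p a b = 0.

Let h := boundary_series rho (fun l : 'I_K.+1 => p 0 l).

(** Balance at [(j.-1, k)] yields [p j k], free of the diagonal source since [j < k]. The outer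
    induction descends from the zero row [K.+1]; the inner one is strong because two previous values
    of [j] enter. *)
Lemma mass_above j k : (j < k <= K.+1)%N -> p j k = h k j - h k j.+1.
Proof.
move=> /andP[jk kK]; have {kK} [m kE] : exists m, k = (K.+1 - m)%N.
  by exists (K.+1 - k)%N; rewrite subKn.
elim: m k kE j jk => [|m IH] k kE j jk.
  by rewrite kE subn0 /h !boundary_series_out subrr p_out //; lia.
have kK : (k <= K)%N by lia.
have [mK|Km] := ltnP m K.+1; last by lia.
have {}IH := IH k.+1 ltac:(lia).
elim/ltn_ind: j jk => -[|[|j]] IHj jk.
- have kK1 : (k < K.+1)%N by [].
  rewrite /h boundary_series0 (boundary_series1 rho _ (Ordinal kK1)).
  by rewrite opprK add0r.
- have k0K : (0 < k <= K)%N by rewrite kK ltnW.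
  have := balanced_above p_balanced k0K.
  rewrite (IHj 0%N) ?(ltnW jk) // IH // ltn_eqF // !mulr0n.
  by rewrite /h boundary_series_rec !boundary_series0 => /= *; lra.
have jkK : (j.+1 < k <= K)%N by rewrite kK ltnW.
have := balanced_above p_balanced jkK.
rewrite (IHj j.+1) ?(ltnW jk) //= (IHj j) ?(ltnW (ltnW jk)) ?leqnSn //.
rewrite IH; last by rewrite ltnW // ltnW.
rewrite ltn_eqF // mulr0n mulr1n /h !boundary_series_rec.
by move=> *; lra.
Qed.

Hypothesis p_sym : forall a b, p a b = p b a.

Lemma mass_diag k : (k < K)%N -> rho * p k k = - h k.+1 k.+1.
Proof.
(* Half the flux through the cut: the maximum rises from [k] only at [(k, k)], and drops from [k.+1]
   only by a departure from the strictly longer queue. *)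
move=> kK; suff -> : rho * p k k = \sum_(a < k.+1) p a k.+1.
  rewrite (eq_bigr (fun a : 'I_k.+1 => h k.+1 a - h k.+1 a.+1)); last first.
    by move=> a _; apply: mass_above; rewrite ltn_ord /= ltnW.
  rewrite -(big_mkord xpredT (fun a => h k.+1 a - h k.+1 a.+1)).
  rewrite -[LHS]opprK -sumrN; under eq_bigr do rewrite opprB.
  by rewrite telescope_sumr // /h boundary_series0 subr0.
elim: k kK => [|k IH] kK.
  have := balanced_diag p_balanced (leq0n K) p_sym.
  by rewrite kK big_ord1 mulr1n mulr0n addr0 add0r.
have := balanced_diag p_balanced (ltnW kK) p_sym.
rewrite kK /= !mulr1n.
(* Summed over row [k.+1], the source [rho * p k k] cancels the row total by induction; the diagonal
   equation at [k.+1] then gives the next cut. *)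
have := row_sum (2 * rho) (p^~ k.+1) k.
rewrite -IH ?(ltnW kK) // [in X in _ -> _ -> _ = X]big_ord_recr /=.
rewrite (eq_bigr (fun a : 'I_k.+1 =>
  rho * p a a *+ (a == k :> nat) + p a k.+2)); last first.
  move=> a _; have aK : (a < k.+1 <= K)%N by rewrite ltn_ord ltnW.
  rewrite (balanced_above p_balanced aK) eqSS; ring.
rewrite big_split /= big_ord_recr /= eqxx mulr1n big1 ?add0r; last first.
  by move=> a _; rewrite ltn_eqF.
by move=> *; lra.
Qed.

Lemma mass_corner : (0 < K)%N ->
  p K K = 2 * rho * p 0 K * (jsq_g rho K.-1 - jsq_g rho K).
Proof.
move=> K_gt0; have := balanced_diag p_balanced (leqnn K) p_sym.
rewrite ltnn K_gt0 mulr0n mulr1n add0r mul1r.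
rewrite (@p_out K K.+1) ?addr0; last by lia.
move=> ->; rewrite mass_above; last by lia.
rewrite prednK // /h /boundary_series.
have only_max (f : 'I_K.+1 -> R) : \sum_(l < K.+1 | (K <= l)%N) f l = f ord_max.
  by apply: big_pred1 => l; rewrite /= -val_eqE /=; have := ltn_ord l; lia.
by rewrite !only_max /= subnn /=; ring.
Qed.

Lemma boundary_relation k : (k < K)%N ->
  h k k.+2 - (2 + rho) * h k k.+1 = 0.
Proof.
(* The relation is [rho] times this equation: the recurrence trades [h k k.+2] for [h k.+1 k.+1],
   which is [- rho * p k k]. *)
move=> kK; suff : h k k.+1 - 2 * h k k + p k k = 0.
  have := mass_diag kK; rewrite /h boundary_series_rec => *; nra.
(* For index 0 this is [h 0 1 = - p 0 0]; otherwise it is balance at [(k, k.+1)], where all but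
   [p k.+1 k.+1] is expressed by [h]. *)
case: k kK => [|k] kK.
  by rewrite /h boundary_series0 (boundary_series1 rho _ ord0) /=; lra.
have kK1 : (k < k.+1 <= K)%N by rewrite ltnSn ltnW.
have := balanced_above p_balanced kK1.
rewrite eqxx mulr1n mass_diag ?(ltnW kK) //.
rewrite (@mass_above k k.+1) ?(@mass_above k k.+2) ?ltnSn //=; try by lia.
case: k kK {kK1} => [|k] kK /=.
  rewrite mulr0n /h !boundary_series_rec !boundary_series0 => *; lra.
rewrite mulr1n (@mass_above k k.+2); last by lia.
by rewrite /h !boundary_series_rec => *; lra.
Qed.

End BoundaryFormula.

(** * Uniqueness for the triangular system *)

Lemma jsq_g_double (R : realType) (rho : R) k : 0 < rho ->
  jsq_g rho k.+1 < 2 * jsq_g rho k.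
Proof.
move=> rho_gt0; case: k => [|k]; first by rewrite jsq_g0 jsq_g1; lra.
(* The recurrence reads [g (k+2) = 2 g (k+1) - 2 rho (g k - g (k+1))]. *)
have : 0 < rho * (jsq_g rho k - jsq_g rho k.+1).
  by rewrite mulr_gt0 // subr_gt0 jsq_g_decr.
by rewrite jsq_g_rec => *; lra.
Qed.

(** Back substitution from [l = K]: once the later entries vanish, relation [l] involves [x l]
    alone. *)
Lemma boundary_relations_inj (R : realType) (rho : R) (K : nat)
    (x : 'I_K.+1 -> R) : 0 < rho -> x ord_max = 0 ->
  (forall k, (k < K)%N ->
     boundary_series rho x k k.+2 - (2 + rho) * boundary_series rho x k k.+1
       = 0) ->
  forall l, x l = 0.
Proof.
move=> rho_gt0 x_max rel l; have [n] := ubnP (K - l).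
elim: n l => // n IH l lt_n.
have [lK|Kl] := ltnP l K; last first.
  by rewrite -[RHS]x_max; congr x; apply: val_inj => /=; have := ltn_ord l; lia.
have only_l j : boundary_series rho x l j = x l * jsq_g rho j.
  rewrite /boundary_series (bigD1 l) //= subnn big1 ?addr0 // => i /andP[li il].
  by rewrite IH ?mul0r //; move: li il; rewrite -val_eqE /=; lia.
have := rel _ lK; rewrite !only_l mulrCA -mulrBr => /eqP; rewrite mulf_eq0.
case/orP => [/eqP //|/eqP c0].
(* The coefficient of [x l] equals [- rho (2 g l - g (l+1))]. *)
have : 0 < rho * (2 * jsq_g rho l - jsq_g rho l.+1).
  by rewrite mulr_gt0 // subr_gt0 jsq_g_double.
by rewrite jsq_g_rec in c0; move=> *; lra.
Qed.

Unset Implicit Arguments.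

Theorem theorem3 (R : realType) (rho : R) (K : nat) (pi : jsq_state K -> R)
    (rho_gt0 : 0 < rho) (K_gt0 : (1 <= K)%N)
    (pi_inv : jsq_invariant rho pi) :
  let g := jsq_g rho in
  let gpow := convolution_power g in
  (* (i) *)
  ((forall j k : 'I_K.+1, (j < k)%N ->
      pi (j, k) =
        \sum_(l < K.+1 | (k <= l)%N)
           pi (ord0, l) * (gpow (l - k + 1)%N j - gpow (l - k + 1)%N (j + 1)%N))
   /\
   (forall k : 'I_K.+1, (k < K)%N ->
      pi (k, k) =
        - (1 / rho) *
          \sum_(l < K.+1 | (k + 1 <= l)%N)
             pi (ord0, l) * gpow (l - k)%N (k + 1)%N))
  /\
  (* (ii) *)
  (forall x : 'I_K.+1 -> R,
     (x ord_max = pi (ord_max, ord_max) / (2 * rho * (g (K - 1)%N - g K))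
      /\
      (forall k : nat, (k < K)%N ->
         \sum_(l < K.+1 | (k <= l)%N)
            x l * (gpow (l - k + 1)%N (k + 2)%N
                   - (2 + rho) * gpow (l - k + 1)%N (k + 1)%N) = 0))
     <->
     (forall l : 'I_K.+1, x l = pi (ord0, l))).
Proof.
move=> g gpow.
pose p := extended_mass pi.
have p_bal : balanced rho K p by exact: extended_mass_balanced.
have p_out a b : ~~ ((a <= K) && (b <= K))%N -> p a b = 0.
  exact: extended_mass_out.
have p_sym a b : p a b = p b a by exact: (balanced_sym rho_gt0 p_bal).
have piE (j k : 'I_K.+1) : pi (j, k) = p j k by rewrite /p extended_massE.
have relE (x : 'I_K.+1 -> R) k :
    \sum_(l < K.+1 | (k <= l)%N)
       x l * (gpow (l - k + 1)%N (k + 2)%N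
              - (2 + rho) * gpow (l - k + 1)%N (k + 1)%N) =
    boundary_series rho x k k.+2 - (2 + rho) * boundary_series rho x k k.+1.
  rewrite /boundary_series mulr_sumr -sumrB addn2 addn1.
  by apply: eq_bigr => l _; rewrite mulrBr mulrCA.
split; [split=> [j k jk|k kK]|move=> x].
- rewrite piE (mass_above p_bal p_out) ?jk ?(ltnW (ltn_ord k)) //.
  rewrite /boundary_series -sumrB addn1; apply: eq_bigr => l _.
  by rewrite piE mulrBr.
- have /(canRL (mulKf (lt0r_neq0 rho_gt0))) := mass_diag p_bal p_out p_sym kK.
  rewrite piE => ->; rewrite div1r mulrN mulNr !addn1; congr (- (_ * _)).
  apply: eq_bigr => l kl; rewrite piE; congr (_ * gpow _ _); lia.
have corner : pi (ord0, ord_max) =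
    pi (ord_max, ord_max) / (2 * rho * (g (K - 1)%N - g K)).
  have c_gt0 : 0 < 2 * rho * (g (K - 1)%N - g K).
    rewrite !mulr_gt0 // subr_gt0 /g -[X in jsq_g rho X < _](subnK K_gt0) addn1.
    exact: jsq_g_decr.
  rewrite !piE (mass_corner p_bal p_out p_sym K_gt0) -subn1.
  by rewrite [2 * rho * _ * _]mulrAC [_ * p _ _]mulrC mulfK // lt0r_neq0.
have rel k : (k < K)%N ->
    boundary_series rho (fun l => pi (ord0, l)) k k.+2
    - (2 + rho) * boundary_series rho (fun l => pi (ord0, l)) k k.+1 = 0.
  move=> kK; rewrite -(boundary_relation p_bal p_out p_sym kK).
  by congr (_ - _ * _); apply: eq_bigr => l _; rewrite piE.
split=> [[x_max x_rel] l|xE].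
  (* The difference of [x] and the boundary masses solves the homogeneous system. *)
  apply/eqP; rewrite -subr_eq0; apply/eqP; move: l.
  apply: (boundary_relations_inj rho_gt0) => // [|k kK].
    by rewrite x_max corner subrr.
  have subE j : boundary_series rho (fun l => x l - pi (ord0, l)) k j =
      boundary_series rho x k j
      - boundary_series rho (fun l => pi (ord0, l)) k j.
    by rewrite /boundary_series -sumrB; apply: eq_bigr => l _; rewrite mulrBl.
  have := x_rel k kK; rewrite relE !subE; have := rel k kK.
  by move=> *; lra.
split=> [|k kK]; first by rewrite xE.
rewrite relE -[RHS](rel k kK).
by congr (_ - _ * _); apply: eq_bigr => l _; rewrite xE.
Qed.
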